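(* Every infinite compact group $G$ has a subgroup which is not a Borel subset of $G$.
   Context: Compact groups are compact Hausdorff topological groups. Subgroups are not assumed to be closed. Borel subsets are the members of the $\sigma$-algebra generated by the open sets. *)

(* Defs.v *)
From HB Require Import structures.
From mathcomp Require Import all_boot.
From mathcomp Require Import all_classical all_reals all_analysis.

Set Implicit Arguments.
Unset Strict Implicit.
Unset Printing Implicit Defensive.

Local Open Scope classical_set_scope.
Local Open Scope group_scope.

(* Not necessarily abelian, hence multiplicative; the continuity of the product
   is joint, i.e., with respect to the product topology on G * G. *)
HB.mixin Record isTopologicalGroup G & Topological G & Group G := {
  mulg_continuous : continuous (fun x : G * G => x.1 * x.2);
  invg_continuous : continuous (fun x : G => x^-1)
}.

#[short(type="topologicalGroupType")]
HB.structure Definition TopologicalGroup :=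
  {G of Topological G & Group G & isTopologicalGroup G}.

Definition compact_group (G : topologicalGroupType) :=
  compact [set: G] /\ hausdorff_space G.

(* The set H is turned into a boolean predicate to match group_closed; no
   topological closedness is implied. *)
Definition is_subgroup (G : groupType) (H : set G) := group_closed [in H].

Definition borel (G : topologicalType) : set_system G := <<s @open G >>.

(* Main.v *)
Require Import Defs.
From mathcomp Require Import all_boot.
From mathcomp Require Import all_classical all_reals all_analysis.

(* An infinite compact group G has no isolated points, so the graph of a group
   word x_0 = w(x_1, ..., x_k) is closed with empty interior. As in Mycielski's
   theorem, this yields a Cantor scheme of open sets of G whose branches K_y
   (y in the Cantor space) are nonempty compact sets that are independent: K_y
   is disjoint from the subgroup generated by the other branches. Hence for every
   set S of branches the subgroup H generated by the K_y with y in S contains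
   K_y when y is in S and is disjoint from K_y otherwise.
   Since G need not be metrizable, the branches need not be points. If H is
   Borel, restrict to a minimal closed set L meeting all branches: the map
   sending L `&` K_y to y is then irreducible, which makes it possible to
   transfer the Baire property from H to S. A nonprincipal ultrafilter S does
   not have this property. *)

Set Implicit Arguments.
Unset Strict Implicit.
Unset Printing Implicit Defensive.

Local Open Scope classical_set_scope.

(** * Comeagre subsets of the Cantor space *)

Definition cyl (t : bitseq) : set (nat -> bool) :=
  [set y | mkseq y (size t) = t].

(** Each [D n] encodes a dense open set, the union of the cylinders of its words; density says that
    every word extends into [D n]. *)
Definition comeagre (Q : set (nat -> bool)) :=
  exists D : nat -> set bitseq,
    (forall n u, exists2 v, prefix u v & D n v) /\
    (forall y, (forall n, exists m, D n (mkseq y m)) -> Q y).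

Lemma prefix_nth (s t : bitseq) i :
  prefix s t -> i < size s -> nth false t i = nth false s i.
Proof. by case/prefixP => u ->; rewrite nth_cat => ->. Qed.

Lemma mkseq_prefix (y : nat -> bool) m n :
  m <= n -> prefix (mkseq y m) (mkseq y n).
Proof.
move=> mn; rewrite prefixE size_mkseq; apply/eqP.
apply: (@eq_from_nth _ false).
  by rewrite size_take !size_mkseq; case: ltngtP mn => // ->.
rewrite size_take !size_mkseq => i; have -> : (if m < n then m else n) = m.
  by case: ltngtP mn => // ->.
by move=> im; rewrite nth_take// !nth_mkseq// (leq_trans im).
Qed.

Lemma cyl_mkseq (y : nat -> bool) n : cyl (mkseq y n) y.
Proof. by rewrite /cyl/= size_mkseq. Qed.

Lemma cylP (t : bitseq) y :
  cyl t y <-> forall i, i < size t -> y i = nth false t i.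
Proof.
split=> [ty i it|yt]; first by rewrite -[in RHS]ty nth_mkseq.
by apply: (@eq_from_nth _ false); rewrite size_mkseq// => i it;
  rewrite nth_mkseq ?yt.
Qed.

Lemma cyl_prefix (s t : bitseq) : prefix s t -> cyl t `<=` cyl s.
Proof.
move=> st y /cylP yt; apply/cylP => i si.
by rewrite yt ?(prefix_nth st)// (leq_trans si)// size_prefix.
Qed.

Lemma baire_category (Q : set (nat -> bool)) t :
  comeagre Q -> exists2 y, cyl t y & Q y.
Proof.
move=> [D [Dd DQ]].
have /choice[e He] : forall nu : nat * bitseq,
    exists v, prefix nu.2 v /\ D nu.1 v.
  by move=> [n u]; have [v] := Dd n u; exists v.
(* The appended [false] forces lengths to grow, so that the words determine a point. *)
pose s := fix s n := if n is n'.+1 then e (n', rcons (s n') false) else t.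
have s_pre n : prefix (s n) (s n.+1).
  exact: prefix_trans (prefix_rcons _ _) (He (n, rcons (s n) false)).1.
have s_le m n : m <= n -> prefix (s m) (s n).
  elim: n => [|n IH]; first by rewrite leqn0 => /eqP ->; exact: prefix_refl.
  rewrite leq_eqVlt => /predU1P[->|/IH smn]; first exact: prefix_refl.
  exact: prefix_trans smn (s_pre n).
have s_size n : n <= size (s n).
  elim: n => // n IH; apply: (leq_ltn_trans IH).
  by have := size_prefix (He (n, rcons (s n) false)).1; rewrite size_rcons.
pose y i := nth false (s i.+1) i.
have ys n : cyl (s n) y.
  apply/cylP => i isn; rewrite /y; case: (leqP n i.+1) => ni.
    by rewrite (prefix_nth (s_le _ _ ni)).
  by rewrite -(prefix_nth (s_le _ _ (ltnW ni)))// s_size.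
exists y; first exact: (ys 0).
apply: DQ => n; exists (size (s n.+1)); rewrite (ys n.+1).
exact: (He (n, _)).2.
Qed.

Lemma comeagre_forall (I : countType) (Q : I -> set (nat -> bool)) :
  (forall i, comeagre (Q i)) -> comeagre [set y | forall i, Q i y].
Proof.
move=> /choice[D HD].
(* Countably many sequences of dense open sets are merged by coding pairs; numbers that code no pair
   get the whole space. *)
exists (fun k => if unpickle k is Some (i, n) then D i n else setT); split.
  move=> k u; case: (unpickle k) => [[i n]|]; first exact: (HD i).1.
  by exists u => //; exact: prefix_refl.
move=> y Hy i; apply: (HD i).2 => n.
by have := Hy (pickle (i, n)); rewrite pickleK.
Qed.

Lemma comeagreS (P Q : set (nat -> bool)) :
  P `<=` Q -> comeagre P -> comeagre Q.
Proof. by move=> PQ [D [Dd DP]]; exists D; split => // y /DP/PQ. Qed.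

Lemma comeagreI (P Q : set (nat -> bool)) :
  comeagre P -> comeagre Q -> comeagre (P `&` Q).
Proof.
move=> cP cQ; have := @comeagre_forall bool (fun b => if b then P else Q).
move=> /(_ _)/(@comeagreS _ (P `&` Q)); apply; last by case.
by move=> y H; split; [apply: (H true)|apply: (H false)].
Qed.

(** A dense open part of the clopen cylinder of [s], united with the complement of this cylinder, is
    dense and open in the whole space. *)
Lemma comeagre_dense (s : bitseq) (T : set bitseq) :
  (forall u, prefix s u -> exists2 v, prefix u v & T v) ->
  comeagre [set y | cyl s y -> exists2 t, T t & cyl t y].
Proof.
move=> Td.
exists (fun _ => [set v | size s <= size v /\
   (prefix s v -> exists2 t, T t & prefix t v)]); split.
  move=> _ u.
  (* Padding to at least the length of [s] decides whether extensions of [u'] begin with [s]. *)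
  pose u' := u ++ nseq (size s) false.
  have uu' : prefix u u' by exact: prefix_prefix.
  have su' : size s <= size u' by rewrite size_cat size_nseq leq_addl.
  case: (boolP (prefix s u')) => [su|nsu].
    have [v uv Tv] := Td _ su; exists v; first exact: prefix_trans uv.
    split; first exact: leq_trans su' (size_prefix uv).
    by move=> _; exists v => //; exact: prefix_refl.
  by exists u' => //; split=> //; rewrite (negbTE nsu).
move=> y Hy sy; have [m [/= + Hm]] := Hy 0; rewrite size_mkseq => sm.
case: Hm => [|t Tt tm]; first by rewrite -sy; exact: mkseq_prefix.
by exists t => //; apply: (cyl_prefix tm); exact: cyl_mkseq.
Qed.

(** * A set neither comeagre nor meagre in any cylinder *)

Definition flip_from (k : nat) (y : nat -> bool) (i : nat) : bool :=
  if i < k then y i else ~~ y i.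

Lemma flip_fromK k : involutive (flip_from k).
Proof.
by move=> y; apply/funext => i; rewrite /flip_from; case: (i < k); rewrite ?negbK.
Qed.

(** The flip acts on finite words by a prefix-preserving involution [f], which carries dense
    families of words to dense families. *)
Lemma comeagre_flip_from k (Q : set (nat -> bool)) :
  comeagre Q -> comeagre [set y | Q (flip_from k y)].
Proof.
pose f (u : bitseq) := mkseq (flip_from k (nth false u)) (size u).
have fmk y m : f (mkseq y m) = mkseq (flip_from k y) m.
  rewrite /f size_mkseq; apply: (@eq_from_nth _ false); rewrite ?size_mkseq//.
  by move=> i im; rewrite !nth_mkseq// /flip_from nth_mkseq.
have fK : involutive f.
  move=> u; rewrite [f u]/f fmk flip_fromK.
  by apply: (@eq_from_nth _ false); rewrite ?size_mkseq// => i iu;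
    rewrite nth_mkseq.
have fpre u v : prefix u v -> prefix (f u) (f v).
  move=> uv; have -> : f u = mkseq (flip_from k (nth false v)) (size u).
    apply: (@eq_from_nth _ false); rewrite ?size_mkseq// => i iu.
    by rewrite !nth_mkseq// /flip_from (prefix_nth uv).
  by apply: mkseq_prefix; exact: size_prefix.
move=> [D [Dd DQ]]; exists (fun n => f @^-1` D n); split.
  move=> n u; have [v uv Dv] := Dd n (f u); exists (f v).
    by rewrite -[u]fK; exact: fpre.
  by rewrite /preimage/= fK.
move=> y Hy; apply: DQ => n; have [m] := Hy n; exists m.
by rewrite -fmk.
Qed.

(* [S] is a nonprincipal ultrafilter on the natural numbers: flipping all but
   finitely many coordinates exchanges it with its complement. *)
Lemma exists_nowhere_baire_set : exists S : set (nat -> bool), forall t,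
  ~ comeagre [set y | cyl t y -> S y] /\ ~ comeagre [set y | cyl t y -> ~ S y].
Proof.
have [U [UU Uoo]] := ultraFilterLemma (F := \oo) _.
exists [set y | U [set n | y n]] => t.
(* The flip beyond [size t] preserves the cylinder of [t], so both conditions are generic there and
   have a common point. *)
have key (P : set (nat -> bool)) : comeagre [set y | cyl t y -> P y] ->
    exists y, P y /\ P (flip_from (size t) y).
  move=> cP; have := comeagreI cP (comeagre_flip_from (size t) cP).
  move=> /(baire_category t)[y ty [/(_ ty) Py /= Pfy]].
  exists y; split=> //; apply: Pfy; apply/cylP => i it.
  by rewrite /flip_from it; exact: (cylP _ _).1.
(* As [U] refines [\oo], the coordinates below [size t], left alone by the flip, can be ignored. *)
have ge_U : U [set n | size t <= n] by apply: Uoo; exists (size t).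
have disj (P Q : set nat) : U P -> U Q ->
    (forall n, size t <= n -> P n -> Q n -> False) -> False.
  move=> UP UQ H; have : U set0.
    apply: filterS (filterI ge_U (filterI UP UQ)) => n [/= tn [Pn Qn]].
    exact: H Pn Qn.
  exact: filter_not_empty.
split=> /key[y [/= Uy Ufy]].
  apply: (disj _ _ Uy Ufy) => n tn /= yn.
  by rewrite /flip_from ltnNge tn yn.
have UC P : ~ U P -> U (~` P) by case: (in_ultra_setVsetC P UU).
apply: (disj _ _ (UC _ Uy) (UC _ Ufy)) => n tn /= yn.
by rewrite /flip_from ltnNge tn/=; case: (y n) yn.
Qed.

(** * Branches of Cantor schemes in compact spaces *)

Definition cantor_scheme (T : topologicalType) (W : bitseq -> set T) :=
  [/\ forall t, open (W t), forall t, W t !=set0,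
      forall t b, closure (W (rcons t b)) `<=` W t &
      forall t u, size t = size u -> t <> u -> W t `&` W u = set0].

Definition branch (T : Type) (W : bitseq -> set T) (y : nat -> bool) : set T :=
  \bigcap_n W (mkseq y n).

Lemma compact_seq_cluster (T : topologicalType) (u : nat -> T) :
  compact [set: T] ->
  exists p : T, forall A N, nbhs p A -> exists2 n, N <= n & A (u n).
Proof.
move=> /(_ (fmap u \oo) _ filterT)[p [_ clp]]; exists p => A N pA.
have uN : fmap u \oo [set u n | n in [set n | N <= n]].
  by exists N => // n /= Nn; exists n.
by have [_ [[n /= Nn <-] An]] := clp _ _ uN pA; exists n.
Qed.

Lemma mkseqSr (y : nat -> bool) n : mkseq y n.+1 = rcons (mkseq y n) (y n).
Proof. by rewrite /mkseq -addn1 iotaD map_cat cats1. Qed.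

Section branches.
Variables (T : topologicalType) (W : bitseq -> set T).
Hypotheses (cT : compact [set: T]) (WS : cantor_scheme W).

Lemma scheme_le y m n : m <= n -> W (mkseq y n) `<=` W (mkseq y m).
Proof.
case: WS => _ _ Wcl _; elim: n => [|n IH]; first by rewrite leqn0 => /eqP ->.
rewrite leq_eqVlt => /predU1P[->//|/IH]; apply: subset_trans.
by rewrite mkseqSr => x Wx; apply: (Wcl _ (y n)); exact: subset_closure.
Qed.

Lemma branch_closure y p :
  (forall n, closure (W (mkseq y n)) p) -> branch W y p.
Proof.
case: WS => _ _ Wcl _ Hp n _; apply: (Wcl _ (y n)).
by rewrite -mkseqSr.
Qed.

Lemma branch_cyl s y : cyl s y -> branch W y `<=` W s.
Proof. by move=> sy x /(_ (size s) I); rewrite sy. Qed.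

Lemma branch_cylC s y : ~ cyl s y -> branch W y `<=` ~` W s.
Proof.
case: WS => _ _ _ Wdisj nsy x /(_ (size s) I) Wx Wsx.
suff : (W (mkseq y (size s)) `&` W s) x by rewrite Wdisj// size_mkseq.
by [].
Qed.

(** Otherwise points of the stages outside [U] would cluster at a point of the branch outside [U].
    This is upper semicontinuity of [branch W]. *)
Lemma branch_usc y U : open U -> branch W y `<=` U ->
  exists n, W (mkseq y n) `<=` U.
Proof.
move=> oU yU; apply/not_existsP => nWU.
have /choice[x Hx] : forall n, exists x, W (mkseq y n) x /\ ~ U x.
  move=> n; apply: contrapT => /forallNP H; apply: (nWU n) => x Wx.
  by apply: contrapT => nUx; apply: (H x).
have [p Hp] := compact_seq_cluster x cT.
have /yU Up : branch W y p.
  apply: branch_closure => n A /(Hp _ n)[m nm Am].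
  by exists (x m); split=> //; apply: (scheme_le nm); exact: (Hx m).1.
have [n _ Un] := Hp U 0 (open_nbhs_nbhs (conj oU Up)).
exact: (Hx n).2.
Qed.

Lemma branch_neq0 y : branch W y !=set0.
Proof.
apply/set0P/negP => /eqP y0; have [||n] := @branch_usc y set0; first exact: open0.
  by rewrite y0.
by case: WS => _ W0 _ _; have [x Wx /(_ _ Wx)] := W0 (mkseq y n).
Qed.

Lemma branch_compact y : compact (branch W y).
Proof.
apply: (subclosed_compact _ cT) => // p clp; apply: branch_closure => n.
apply: closure_subset clp => x; exact.
Qed.

(* The complement of [U] is a minimal closed set meeting all branches, so that
   [y |-> branch W y `\` U] is the fibration of an irreducible map. *)
Lemma exists_maximal_open :
  exists U, [/\ open U, forall y, ~ branch W y `<=` U &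
    forall U', open U' -> U `<=` U' -> ~ U' `<=` U ->
      exists y, branch W y `<=` U'].
Proof.
pose P U := open U /\ forall y, ~ branch W y `<=` U.
have [F FP totF|U [[oU nU] maxU]] := @Zorn_bigcup T P.
  split=> [|y yF]; first by apply: bigcup_open => U /FP[].
  have [p0 p0y] := branch_neq0 y.
  have [U0 FU0 _] := yF _ p0y.
  (* The complements of the members of the chain trace a filter base on the compact branch; a
     cluster point lies in no member of the chain. *)
  pose B := filter_from F (fun U => branch W y `\` U).
  have BF : ProperFilter B.
    apply: filter_from_proper; last first.
      move=> U FU; apply: contrapT => H; apply: ((FP _ FU).2 y) => x xy.
      by apply: contrapT => nUx; apply: H; exists x.
    apply: filter_from_filter; first by exists U0.
    move=> A C FA FC; have [AC|CA] := totF _ _ FA FC.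
      by exists C => // x [xy nCx]; split; split=> // /AC.
    by exists A => // x [xy nAx]; split; split=> // /CA.
  have By : B (branch W y) by exists U0 => // x [].
  have [p [py clp]] := branch_compact BF By.
  have [U FU Up] := yF _ py.
  have BU : B (branch W y `\` U) by exists U.
  by have [x [[_ nUx] /nUx]] :=
    clp _ _ BU (open_nbhs_nbhs (conj (FP _ FU).1 Up)).
exists U; split=> // U' oU' UU' nU'U; apply: contrapT => /forallNP nU'.
exact: (maxU U').
Qed.

(** The sets [A] with [D A], which generically contain or miss [K y] on densely many cylinders, form
    a sigma-algebra; irreducibility puts the open sets into it. *)
Lemma borel_branch (B : set T) (S : set (nat -> bool)) : borel B ->
  (forall y, S y -> branch W y `<=` B) ->
  (forall y, ~ S y -> branch W y `<=` ~` B) ->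
  exists t, comeagre [set y | cyl t y -> S y] \/
            comeagre [set y | cyl t y -> ~ S y].
Proof.
have [U [oU nU maxU]] := exists_maximal_open.
pose K y := branch W y `\` U.
have K0 y : K y !=set0.
  apply: contrapT => H; apply: (nU y) => x xy.
  by apply: contrapT => nUx; apply: H; exists x.
pose most t A := comeagre [set y | cyl t y -> K y `<=` A].
pose D A := forall s, exists2 t, prefix s t & most t A \/ most t (~` A).
have mostS t A C : A `<=` C -> most t A -> most t C.
  by move=> AC; apply: comeagreS => y /[apply] yA x /yA /AC.
have mostW s t A : prefix s t -> most s A -> most t A.
  by move=> st; apply: comeagreS => y H /(cyl_prefix st) /H.
have most_all t A : (forall y, cyl t y -> K y `<=` A) -> most t A.
  move=> H; exists (fun _ => setT); split; last by move=> y _ /H.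
  by move=> _ u; exists u => //; exact: prefix_refl.
(* Since [K y] is a nonempty part of the branch, a generic decision about [B] is one about [S]. *)
suff BD : borel B -> D B.
  move=> /BD /(_ [::])[t _ H] SB nSB; exists t.
  case: H => H; [left|right]; apply: comeagreS H => y /= /[apply] Ky.
    apply: contrapT => /nSB yB; have [x Kx] := K0 y.
    by apply: (yB x); [case: Kx|exact: Ky].
  move=> /SB yB; have [x Kx] := K0 y.
  by apply: (Ky x) => //; apply: yB; case: Kx.
move: B; apply: smallest_sub; first split.
- move=> s; exists s; first exact: prefix_refl.
  by right; apply: most_all => y _; rewrite setC0.
- move=> A DA s; have [t st H] := DA s; exists t => //.
  by rewrite setTD setCK; case: H; [right|left].
- move=> A DA s.
  (* If no [A n] generically contains [K y] on a cylinder below [s], then each complement does so on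
     densely many of them, and these countably many conditions combine. *)
  case: (pselect (exists n t, prefix s t /\ most t (A n))) => [[n [t [st H]]]|H].
    by exists t => //; left; apply: mostS H => x Ax; exists n.
  exists s; [exact: prefix_refl|right].
  have : comeagre [set y | forall n, cyl s y ->
      exists2 t, most t (~` A n) & cyl t y].
    apply: comeagre_forall => n; apply: comeagre_dense => u su.
    have [t ut [Ht|Ht]] := DA n u; last by exists t.
    by case: H; exists n, t; split=> //; exact: prefix_trans su ut.
  have : comeagre [set y | forall nt : nat * bitseq,
      most nt.2 (~` A nt.1) -> cyl nt.2 y -> K y `<=` ~` A nt.1].
    apply: comeagre_forall => -[n t] /=.
    case: (pselect (most t (~` A n))) => Ht; first by apply: comeagreS Ht => y Hy _.
    exists (fun _ => setT); split=> // _ u.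
    by exists u => //; exact: prefix_refl.
  move=> c1 c2; apply: comeagreS (comeagreI c1 c2) => y [H1 H2] sy x Kx [n _ An].
  have [t mt ty] := H2 n sy.
  exact: (H1 (n, t)) An.
move=> A oA s.
case: (pselect (exists2 y, cyl s y & ~ K y `<=` ~` A)) => [[y sy nKA]|H]; last first.
  exists s; [exact: prefix_refl|right]; apply: most_all => y sy.
  by apply: contrapT => nKA; apply: H; exists y.
have Wo t : open (W t) by case: WS.
(* [U'] exceeds [U] because [K y] meets [A] inside [W s], so by maximality it contains a branch.
   This branch passes through [s], since otherwise it would lie in [U]. *)
pose U' := U `|` (A `&` W s).
have oU' : open U' by apply: openU => //; exact: openI.
have [z zU'] : exists z, branch W z `<=` U'.
  apply: maxU => //; first by move=> x; left.
  move=> U'U; apply: nKA => x [xy nUx] Ax; apply/nUx/U'U; right.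
  by split=> //; exact: (branch_cyl sy).
have sz : cyl s z.
  apply: contrapT => nsz; apply: (nU z) => x xz.
  by have [//|[_]] := zU' _ xz; have := branch_cylC nsz xz.
(* Semicontinuity spreads the inclusion to a cylinder around [z]; off [U] it gives [K y'] inside
   [A]. *)
have [n Wn] := branch_usc oU' zU'.
exists (mkseq z (maxn n (size s))).
  by rewrite -{1}sz mkseq_prefix// leq_maxr.
left; apply: most_all => y' /(branch_cyl) zy' x [xy' nUx].
have : U' x by apply/Wn/(scheme_le (leq_maxl n (size s)))/zy'.
by case=> [//|[]].
Qed.

End branches.

(** * Group words, and the absence of isolated points *)

Section words.
Variable G : topologicalGroupType.
Local Open Scope group_scope.

Definition letter (b : bool) (x : G) : G := if b then x^-1 else x.

(** Occurrences of one letter vary independently in [V i], as is needed when a branch has several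
    points. *)
Fixpoint wset (I : Type) (V : I -> set G) (w : seq (I * bool)) : set G :=
  if w is (i, b) :: w' then
    [set letter b a * c | a in V i & c in wset V w']
  else [set 1].

Fixpoint weval (I : Type) (p : I -> G) (w : seq (I * bool)) : G :=
  if w is (i, b) :: w' then letter b (p i) * weval p w' else 1.

Lemma letter_continuous b : continuous (letter b).
Proof. by case: b => x; [exact: invg_continuous|exact: cvg_id]. Qed.

Lemma wset_map (I J : eqType) (f : I -> J) (A : I -> set G) (B : J -> set G) w :
  (forall l, l \in w -> A l.1 `<=` B (f l.1)) ->
  wset A w `<=` wset B [seq (f l.1, l.2) | l <- w].
Proof.
elim: w => [|[i b] w IH] AB /=; first exact: subset_refl.
move=> _ [a Aa [c wc <-]].
exists a; first by apply: (AB (i, b)) => //; rewrite mem_head.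
exists c => //; apply: IH wc => l lw; apply: AB.
by rewrite in_cons lw orbT.
Qed.

Lemma wset_sub (I : eqType) (A B : I -> set G) w :
  (forall l, l \in w -> A l.1 `<=` B l.1) -> wset A w `<=` wset B w.
Proof.
move=> AB; have := @wset_map _ _ id A B w AB.
by have -> : [seq (id l.1, l.2) | l <- w] = w by elim: w {AB} => [|[? ?] ? /= ->].
Qed.

Lemma wset_cat (I : Type) (A : I -> set G) w1 w2 x y :
  wset A w1 x -> wset A w2 y -> wset A (w1 ++ w2) (x * y).
Proof.
elim: w1 x => [|[i b] w1 IH] x /=; first by move=> -> ; rewrite mul1g.
move=> [a Aa [c wc <-]] wy; exists a => //; exists (c * y); first exact: IH.
by rewrite mulgA.
Qed.

Lemma wset_inv (I : Type) (A : I -> set G) w x :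
  wset A w x -> wset A (rev [seq (l.1, ~~ l.2) | l <- w]) x^-1.
Proof.
elim: w x => [|[i b] w IH] x /=; first by move=> ->; rewrite invg1.
move=> [a Aa [c wc <-]]; rewrite rev_cons -cats1 invgM; apply: wset_cat.
  exact: IH.
exists a => //; exists 1 => //; rewrite mulg1 /letter.
by case: b; rewrite ?invgK.
Qed.

Lemma wset_nbhs (I : Type) (p : I -> G) w O :
  nbhs (weval p w) O ->
  exists V : I -> set G, (forall i, nbhs (p i) (V i)) /\ wset V w `<=` O.
Proof.
elim: w O => [|[i b] w IH] O /= wO.
  by exists (fun _ => setT); split=> [j|x -> /=]; [exact: filterT|exact: nbhs_singleton].
have [[A B] [/= nA nB] ABO] :=
  @mulg_continuous G (letter b (p i), weval p w) O wO.
have [V [pV VB]] := IH _ nB.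
have nA' : nbhs (p i) (letter b @^-1` A) by exact: letter_continuous.
exists (fun j => V j `&` [set x | p j = p i -> A (letter b x)]); split.
  move=> j; apply: filterI => //; case: (pselect (p j = p i)) => [->|nji].
    by apply: filterS nA' => x /=.
  by apply: filterS filterT => x _ /nji.
move=> _ [a [Va Aa] [c wc <-]]; apply: (ABO (letter b a, c)); split => /=.
  exact: Aa.
apply: VB.
have sub J (v : seq (I * bool)) : wset (fun j => V j `&` J j) v `<=` wset V v.
  elim: v => [|[k d] v IHv] /=; first exact: subset_refl.
  move=> _ [a' [Va' _] [c' /IHv wc' <-]].
  by exists a' => //; exists c'.
exact: sub wc.
Qed.

(** By translation one isolated point makes all points isolated, and an infinite discrete space is
    not compact. *)
Lemma nonisolated : compact [set: G] -> infinite_set [set: G] ->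
  forall (U : set G) a, open U -> U !=set0 -> exists2 x, U x & x != a.
Proof.
move=> cG iG U a oU [u Uu]; apply: contrapT => H.
have Ua x : U x -> x = a.
  by move=> Ux; apply/eqP/negPn/negP => xa; apply: H; exists x.
(* Right translation by [z^-1 * u] is injective and maps [z] to [u], the only point of [U]. *)
have single (z : G) : nbhs z [set z].
  have : nbhs (z, z^-1 * u) ((fun x : G * G => x.1 * x.2) @^-1` U).
    apply: mulg_continuous; apply: open_nbhs_nbhs; split=> //=.
    by rewrite mulgA mulgV mul1g.
  move=> [[A B] [/= nA nB] AB]; apply: filterS (nA) => x Ax /=.
  have /Ua/= xa := AB (x, z^-1 * u) (conj Ax (nbhs_singleton nB)).
  have /Ua/= za := AB (z, z^-1 * u) (conj (nbhs_singleton nA) (nbhs_singleton nB)).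
  by apply: (mulIg (z^-1 * u)); rewrite xa za.
have [f f_inj] : exists f : nat -> G, injective f.
  have /card_leP[f] := (infiniteP _).1 iG.
  pose e n : [set: nat] := SigSub (mem_set (I : [set: nat] n)).
  exists (fun n => val (f (e n))) => m n /val_inj/(inj (mem_set I) (mem_set I)).
  by move=> /(congr1 val).
have [p Hp] := compact_seq_cluster f cG.
have [n _ fn] := Hp _ 0 (single p).
have [m nm fm] := Hp _ n.+1 (single p).
by have := f_inj m n; rewrite fm fn => /(_ erefl) mn; rewrite mn ltnn in nm.
Qed.

(** * Construction of an independent Cantor scheme *)

Definition thick (I : Type) (V : I -> set G) :=
  forall i, open (V i) /\ V i !=set0.

Hypotheses (cG : compact [set: G]) (hG : hausdorff_space G).
Hypothesis iG : infinite_set [set: G].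

(* The graph of a word map is closed with empty interior: once the letters
   other than [i] are chosen, the word takes a single value. *)
Lemma shrink_word (I : eqType) (V : I -> set G) i (w : seq (I * bool)) :
  thick V -> i \notin map fst w ->
  exists V', [/\ thick V', forall j, V' j `<=` V j & V' i `&` wset V' w = set0].
Proof.
move=> tV iw; have /choice[p Vp] : forall j, exists x, V j x.
  by move=> j; have [_ [x Vx]] := tV j; exists x.
have [q Vq qw] := nonisolated cG iG (weval p w) (tV i).1 (tV i).2.
move: hG; rewrite open_hausdorff => /(_ _ _ qw).
move=> [[A B] /= [qA wB] [oA oB /eqP AB]].
have [V1 [pV1 V1B]] : exists V1 : I -> set G,
    (forall j, nbhs (p j) (V1 j)) /\ wset V1 w `<=` B.
  by apply: wset_nbhs; apply: open_nbhs_nbhs; split=> //; rewrite inE in wB.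
exists (fun j => V j `&` (if j == i then A else (V1 j)^°)); split.
- move=> j; split.
    by apply: openI; [exact: (tV j).1|case: ifP => // _; exact: open_interior].
  case: eqP => [->|_]; first by exists q; split=> //; rewrite inE in qA.
  by exists (p j); split; [exact: Vp|exact: pV1].
- by move=> j x [].
apply/seteqP; split=> // x [[_ +] wx]; rewrite eqxx => Ax.
rewrite -AB; split=> //; apply: V1B; apply: wset_sub wx => l lw y [_].
case: eqP => [li|_]; last exact: interior_subset.
by move/negP: iw; rewrite -li map_f.
Qed.

Lemma shrink_words (I : eqType) (V : I -> set G) (cs : seq (I * seq (I * bool))) :
  thick V -> (forall c, c \in cs -> c.1 \notin map fst c.2) ->
  exists V', [/\ thick V', forall j, V' j `<=` V j &
    forall c, c \in cs -> V' c.1 `&` wset V' c.2 = set0].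
Proof.
move=> tV; elim: cs => [|c cs IH] Hcs; first by exists V; split=> // j; exact: subset_refl.
have [|V1 [tV1 V1V V1cs]] := IH.
  by move=> d dcs; apply: Hcs; rewrite in_cons dcs orbT.
have [V2 [tV2 V21 V2c]] := shrink_word tV1 (Hcs _ (mem_head _ _)).
exists V2; split=> [//|j|]; first exact: subset_trans (V21 j) (V1V j).
move=> d; rewrite in_cons => /predU1P[->//|dcs].
apply/seteqP; split=> // x [Vx wx]; rewrite -(V1cs d dcs).
by split; [exact: V21|apply: wset_sub wx => l _; exact: V21].
Qed.

Fixpoint words (T : Type) (s : seq T) n : seq (seq T) :=
  if n is n'.+1 then [::] :: [seq l :: w | l <- s, w <- words s n']
  else [:: [::]].

Lemma mem_words (T : eqType) (s : seq T) n w :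
  size w <= n -> {subset w <= s} -> w \in words s n.
Proof.
elim: w n => [|l w IH] [|n]//= wn ws; rewrite in_cons/=.
apply/allpairsP; exists (l, w); split=> //=; first by apply: ws; rewrite mem_head.
by apply: IH => // x xw; apply: ws; rewrite in_cons xw orbT.
Qed.

(** Bounding word length by the level leaves finitely many conditions per level, yet every word is
    covered at all deep levels. *)
Definition independent_at (V : bitseq -> set G) n := forall t w,
  size t = n -> size w <= n ->
  (forall l, l \in w -> size l.1 = n /\ l.1 <> t) ->
  V t `&` wset V w = set0.

Lemma scheme_step (V : bitseq -> set G) n : thick V ->
  exists V', [/\ thick V',
    forall t, closure (V' t) `<=` V (take n t) & independent_at V' n.+1].
Proof.
move=> tV.
pose S := map val (enum {: n.+1.-tuple bool}).
have memS t : size t = n.+1 -> t \in S.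
  by move=> /eqP tn; apply/mapP; exists (Tuple tn) => //; rewrite mem_enum.
pose L := [seq (t, b) | t <- S, b <- [:: true; false]].
(* The finite list of all conditions at level [n.+1]; each new set will shrink that of its parent
   [take n t]. *)
pose cs := [seq c <- [seq (t, w) | t <- S, w <- words L n.+1] |
  c.1 \notin map fst c.2].
have [||V1 [tV1 V1V V1cs]] := @shrink_words _ (fun t => V (take n t)) cs.
- by move=> t; exact: tV.
- by move=> c; rewrite mem_filter => /andP[].
have /choice[V2 HV2] : forall t, exists A : set G,
    [/\ open A, A !=set0 & closure A `<=` V1 t].
  move=> t; have [oV1 [x V1x]] := tV1 t.
  have [A xA AV] := compact_regular hG cG filterT
    (open_nbhs_nbhs (conj oV1 V1x)).
  exists A^°; split; [exact: open_interior|by exists x|].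
  by apply: subset_trans AV; apply: closure_subset; exact: interior_subset.
have V21 t : V2 t `<=` V1 t.
  by apply: subset_trans (@subset_closure _ _) _; have [] := HV2 t.
exists V2; split.
- by move=> t; have [] := HV2 t.
- by move=> t; have [_ _] := HV2 t; move=> /subset_trans; apply.
move=> t w tn wn Hw; apply/seteqP; split=> // x [Vx wx].
rewrite -(V1cs (t, w)).
  by split; [exact: V21|apply: wset_sub wx => l _; exact: V21].
rewrite mem_filter; apply/andP; split.
  by apply/mapP => -[l /Hw[_ lt] tl]; apply: lt.
apply: allpairs_f; first exact: memS.
apply: mem_words => // -[u b] /Hw[/= un _].
by apply: allpairs_f; [exact: memS|case: b].
Qed.

Lemma exists_independent_scheme : exists W : bitseq -> set G,
  cantor_scheme W /\ forall n, independent_at W n.+1.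
Proof.
have /choice[F HF] : forall nV : nat * (bitseq -> set G), exists V',
    thick nV.2 -> [/\ thick V',
      forall t, closure (V' t) `<=` nV.2 (take nV.1 t) &
      independent_at V' nV.1.+1].
  move=> [n V]; case: (pselect (thick V)) => [tV|ntV]; last by exists V.
  by have [V' HV'] := scheme_step n tV; exists V'.
(* [V n] is defined on all words but matters only at length [n]; the scheme is the diagonal
   [V (size t) t]. *)
pose V := fix V n := if n is n'.+1 then F (n', V n') else fun _ => setT.
have tV n : thick (V n).
  elim: n => [t|n IH]; first by split; [exact: openT|exists 1].
  by have [] := HF (n, V n) IH.
have VS n := HF (n, V n) (tV n).
have indep n : independent_at (fun t => V (size t) t) n.+1.
  move=> t w tn wn Hw; have [_ _ /(_ t w tn wn Hw) VSw] := VS n.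
  apply/seteqP; split=> // x [Vx wx]; rewrite -VSw; split.
    by move: Vx; rewrite tn.
  by apply: wset_sub wx => l /Hw[ln _]; rewrite ln.
exists (fun t => V (size t) t); split=> //; split.
- by move=> t; exact: (tV _ _).1.
- by move=> t; exact: (tV _ _).2.
- move=> t b; rewrite size_rcons; have [_ /(_ (rcons t b)) + _] := VS (size t).
  by rewrite -cats1 /= take_size_cat.
(* Disjointness is independence from the one-letter word [u]; level 0 has only the empty word. *)
move=> t u; case: t => [|b t] tu ntu.
  by case: u tu ntu => //; move=> _ [].
have := indep (size t) (b :: t) [:: (u, false)] erefl isT.
move=> H; apply/seteqP; split=> // x [tx ux].
rewrite -H; first last.
  by move=> l; rewrite inE => /eqP -> /=; split=> //; exact: nesym.
split=> //=; exists x => //; exists 1 => //; exact: mulg1.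
Qed.

(** * Subgroups generated by sets of branches *)

Lemma mkseq_neq (y : nat -> bool) (s : seq (nat -> bool)) : y \notin s ->
  exists N, forall n z, N <= n -> z \in s -> mkseq z n <> mkseq y n.
Proof.
elim: s => [|x s IH]; first by exists 0.
rewrite in_cons negb_or => /andP[yx /IH[N HN]].
have [i xyi] : exists i, x i <> y i.
  apply/existsNP => xy; move/eqP: yx; apply; apply/funext => i.
  by rewrite xy.
exists (maxn N i.+1) => n z; rewrite geq_max => /andP[Nn ni].
rewrite in_cons => /predU1P[->|zs]; last exact: HN.
by move=> /(congr1 (fun s => nth false s i)); rewrite !nth_mkseq.
Qed.

Definition generated (W : bitseq -> set G) (S : set (nat -> bool)) : set G :=
  [set g | exists2 w, (forall l, l \in w -> S l.1) & wset (branch W) w g].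

Lemma generated_subgroup W S : is_subgroup (generated W S).
Proof.
split; first by rewrite inE; exists [::].
move=> x y; rewrite !inE => -[w1 Sw1 w1x] [w2 Sw2 w2y].
exists (w1 ++ rev [seq (l.1, ~~ l.2) | l <- w2]).
  move=> l; rewrite mem_cat mem_rev => /orP[/Sw1//|/mapP[l' /Sw2 + ->]].
  by [].
by apply: wset_cat => //; exact: wset_inv.
Qed.

Lemma branch_generated W (S : set (nat -> bool)) y :
  S y -> branch W y `<=` generated W S.
Proof.
move=> Sy x yx; exists [:: (y, false)].
  by move=> l; rewrite inE => /eqP ->.
by exists x => //; exists 1 => //; exact: mulg1.
Qed.

(** A common element would be a product along a word [w] in finitely many other branches. This
    contradicts independence at a level that separates [y] from the letters of [w] and is at least
    the length of [w]. *)
Lemma branch_generatedC W (S : set (nat -> bool)) y :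
  (forall n, independent_at W n.+1) -> ~ S y ->
  branch W y `<=` ~` generated W S.
Proof.
move=> indep nSy x yx [w Sw wx].
have [|N HN] := @mkseq_neq y (map fst w).
  by apply/mapP => -[l /Sw Sl yl]; apply: nSy; rewrite yl.
pose n := maxn N (size w).
have : (W (mkseq y n.+1) `&`
    wset W [seq (mkseq l.1 n.+1, l.2) | l <- w]) x.
  split; first exact: yx.
  have := @wset_map _ _ (fun y : nat -> bool => mkseq y n.+1) (branch W) W w.
  by move=> /(_ _ x wx); apply => l _ z; exact.
rewrite (indep n)//; first exact: size_mkseq.
  by rewrite size_map leqW// leq_maxr.
move=> _ /mapP[l lw ->]; split; first exact: size_mkseq.
apply: HN; first by rewrite leqW// leq_maxl.
exact: map_f.
Qed.

End words.

Theorem corollary4p6 (G : topologicalGroupType) :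
  compact_group G -> infinite_set [set: G] ->
  exists H : set G, is_subgroup H /\ ~ borel H.
Proof.
move=> [cG hG] iG; have [W [WS indep]] := exists_independent_scheme cG hG iG.
have [S HS] := exists_nowhere_baire_set.
exists (generated W S); split; first exact: generated_subgroup.
move=> /(borel_branch cG WS)/(_ (@branch_generated _ W S)).
move=> /(_ (fun y => @branch_generatedC _ W S y indep))[t].
by case; [exact: (HS t).1|exact: (HS t).2].
Qed.
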